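(* Let $X$ be a real Hilbert space and let $A : X \supseteq \mathcal{D}(A) \to X$ be a densely-defined symmetric linear map. Then $A$ has a self-adjoint extension; that is, there exists a self-adjoint linear map $M : X \supseteq \mathcal{D}(M) \to X$ with $\mathcal{D}(A) \subseteq \mathcal{D}(M)$ and $Mx = Ax$ for all $x \in \mathcal{D}(A)$.
   Context: The scalar product of $X$ is written $(\cdot\,|\,\cdot)$. A linear map $A$ defined on a linear subspace $\mathcal{D}(A)$ of $X$ with values in $X$ is densely-defined if $\mathcal{D}(A)$ is dense in $X$, and symmetric if $(Ax\,|\,y) = (x\,|\,Ay)$ for all $x,y \in \mathcal{D}(A)$. The adjoint $A^*$ of a densely-defined $A$ has domain $\mathcal{D}(A^* ) = \{x \in X : y \mapsto (x\,|\,Ay) \text{ is continuous on } \mathcal{D}(A)\}$, and for $x\in\mathcal{D}(A^* )$, $A^*x$ is the unique element of $X$ with $(A^*x\,|\,y) = (x\,|\,Ay)$ for all $y \in \mathcal{D}(A)$. A densely-defined map $A$ is self-adjoint if $A = A^*$ (including equality of domains); equivalently, $A$ is symmetric and $\mathcal{D}(A) = \mathcal{D}(A^* )$. *)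

(* Defs.v *)
From HB Require Import structures.
From mathcomp Require Import all_boot all_order all_algebra.
From mathcomp Require Import all_classical all_reals all_analysis.

Set Implicit Arguments.
Unset Strict Implicit.
Unset Printing Implicit Defensive.

Import Order.TTheory GRing.Theory Num.Theory.
Import numFieldNormedType.Exports.

Local Open Scope classical_set_scope.
Local Open Scope ring_scope.

(* A real Hilbert space is a complete normed module [X] over [R : realType]
   together with a symmetric positive definite bilinear form
   [ip : {dot X for idfun}] satisfying [induces_norm ip]. *)
Definition induces_norm (R : realType) (X : completeNormedModType R)
    (ip : {dot X for idfun}) : Prop :=
  forall x : X, `|x| = Num.sqrt (ip x x).

(* A map defined on a subset [pdom] of [X] with values in [X]. The underlying
   function is total, but its values outside [pdom] are junk: two such maps are
   to be compared with [eq_partial], never with Leibniz equality. *)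
Record partial_map (X : Type) :=
  PartialMap { pdom : set X ; partial_fun :> X -> X }.

Definition eq_partial (X : Type) (A B : partial_map X) : Prop :=
  pdom A = pdom B /\ forall x, pdom A x -> A x = B x.

Definition extends (X : Type) (M A : partial_map X) : Prop :=
  pdom A `<=` pdom M /\ forall x, pdom A x -> M x = A x.

Definition linear_partial (R : realType) (X : lmodType R)
    (A : partial_map X) : Prop :=
  [/\ pdom A 0,
      forall (a : R) (x y : X), pdom A x -> pdom A y -> pdom A (a *: x + y)
    & forall (a : R) (x y : X), pdom A x -> pdom A y ->
        A (a *: x + y) = a *: A x + A y].

Definition densely_defined (X : topologicalType) (A : partial_map X) : Prop :=
  dense (pdom A).

Definition symmetric_partial (R : realType) (X : lmodType R)
    (ip : {dot X for idfun}) (A : partial_map X) : Prop :=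
  forall x y : X, pdom A x -> pdom A y -> ip (A x) y = ip x (A y).

(* Meaningful for densely defined [A] only: density gives uniqueness of the
   element selected by [xget] (and completeness its existence). *)
Definition adjoint (R : realType) (X : completeNormedModType R)
    (ip : {dot X for idfun}) (A : partial_map X) : partial_map X :=
  PartialMap
    [set x : X | {within pdom A, continuous (fun y : X => ip x (A y))}]
    (fun x : X =>
       xget 0 [set z : X | forall y : X, pdom A y -> ip z y = ip x (A y)]).

Definition self_adjoint (R : realType) (X : completeNormedModType R)
    (ip : {dot X for idfun}) (A : partial_map X) : Prop :=
  densely_defined A /\ eq_partial A (adjoint ip A).

(* Main.v *)
Require Import Defs.
From mathcomp Require Import all_boot all_order all_algebra.
From mathcomp Require Import all_classical all_reals all_analysis.
From mathcomp Require Import ring lra.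
Import Order.TTheory GRing.Theory Num.Theory.
Import numFieldNormedType.Exports.
Local Open Scope classical_set_scope.
Local Open Scope ring_scope.

(** Graphs of operators are subsets of X x X, which carries the symplectic form
    symplectic (x, y) (u, v) = (x | v) - (y | u). An operator is symmetric when
    its graph is isotropic for this form, and a densely defined operator is
    self-adjoint when its graph is Lagrangian, i.e. equal to its own symplectic
    orthogonal.

    Because X is a real space and the scalar product is symmetric, the form is
    alternating: every vector is orthogonal to itself. Hence a maximal isotropic
    set is Lagrangian, since a vector orthogonal to the whole set could
    otherwise be added to it. Over the complex numbers this step breaks down,
    which is where deficiency indices come from. Zorn's lemma thus extends the
    graph of the given operator to a Lagrangian set
    ([isotropic_sub_lagrangian]). Density of the domain makes this set
    single-valued ([lagrangian_functional]), so it is the graph of a linear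
    operator M.

    It remains to compare M with its adjoint, whose domain is defined by a
    continuity condition ([lagrangian_self_adjoint]). If y |-> (x | M y) is
    continuous on the domain of M, then a Riesz representation theorem for
    continuous functionals on a possibly non-closed subspace
    ([riesz_representation]) gives z with (x | M y) = (z | y) for all y, that
    is, (x, z) is orthogonal to the graph of M and so belongs to it. *)

(** * Scalar products *)

Lemma ipC {R : realType} {X : lmodType R} (ip : {dot X for idfun}) (x y : X) :
  ip x y = ip y x.
Proof. by rewrite hermC expr0 mul1r. Qed.

Lemma ip_linear {R : realType} {X : lmodType R} (ip : {dot X for idfun})
    (a : R) (x y z : X) :
  ip (a *: x + y) z = a * ip x z + ip y z.
Proof. by rewrite linearPl. Qed.

Lemma ipBl {R : realType} {X : lmodType R} (ip : {dot X for idfun})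
    (x y z : X) :
  ip (x - y) z = ip x z - ip y z.
Proof. by rewrite linearBl. Qed.

Lemma ip_linear_r {R : realType} {X : lmodType R} (ip : {dot X for idfun})
    (a : R) (x y z : X) :
  ip z (a *: x + y) = a * ip z x + ip z y.
Proof. by rewrite ipC ip_linear !(ipC _ z). Qed.

Section HilbertSpace.
Set Implicit Arguments.
Unset Strict Implicit.
Context (R : realType) (X : completeNormedModType R) (ip : {dot X for idfun}).
Context (ip_norm : induces_norm ip).

Lemma ipxx (x : X) : ip x x = `|x| ^+ 2.
Proof.
rewrite ip_norm sqr_sqrtr //.
by have [->|/(neq0_dnorm_gt0 (s := ip))/ltW//] := eqVneq x 0; rewrite linear0r.
Qed.

Lemma sqr_norm_linear (t : R) (h a : X) :
  `|t *: h + a| ^+ 2 = t ^+ 2 * `|h| ^+ 2 + 2 * t * ip a h + `|a| ^+ 2.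
Proof.
rewrite -!ipxx ip_linear !ip_linear_r (ipC _ h a); ring.
Qed.

(** Expanding both sides of the square of the triangle inequality. *)
Lemma ip_le (x y : X) : ip x y <= `|x| * `|y|.
Proof.
have := sqr_norm_linear 1 x y; rewrite scale1r (ipC _ y x).
have : `|x + y| ^+ 2 <= (`|x| + `|y|) ^+ 2.
  by rewrite ler_sqr ?nnegrE ?addr_ge0 // ler_normD.
lra.
Qed.

Lemma cauchy_schwarz (x y : X) : `|ip x y| <= `|x| * `|y|.
Proof.
rewrite ler_norml ip_le andbT lerNl -mulN1r.
by have := ip_le (- x) y; rewrite normrN -scaleN1r linearZl_LR.
Qed.

Lemma ip_continuous (z : X) : continuous (ip z).
Proof.
move=> y; apply/cvgrPdist_lt => e e0; near=> w.
have -> : ip z y - ip z w = ip z (y - w) by rewrite linearBr.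
apply: le_lt_trans (cauchy_schwarz _ _) _.
apply: (@le_lt_trans _ _ ((`|z| + 1) * `|y - w|)).
  by apply: ler_wpM2r => //; rewrite lerDl.
have z0 : 0 < `|z| + 1 by rewrite ltr_wpDl.
rewrite mulrC -ltr_pdivlMr //.
near: w; apply/nbhs_normP; exists (e / (`|z| + 1)) => //=; exact: divr_gt0.
Unshelve. all: by end_near. Qed.

(** If w is nonzero, some y in D lies at distance less than |w| from w, whereas
    |w - y|^2 = |w|^2 + |y|^2 by orthogonality. *)
Lemma dense_orthogonal_eq0 (D : set X) (w : X) :
  dense D -> (forall y, D y -> ip w y = 0) -> w = 0.
Proof.
move=> dD wD; apply/eqP/negP => /negP w0.
have n0 : 0 < `|w| by rewrite normr_gt0.
have [|y [wy Dy]] := dD (ball w `|w|) _ (ball_open _ _).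
  by exists w; exact: ballxx n0.
move: wy; rewrite -ball_normE /= => wy.
have := sqr_norm_linear (-1) y w; rewrite scaleN1r addrC wD //.
have : `|w - y| ^+ 2 < `|w| ^+ 2 by rewrite ltr_sqr ?nnegrE.
have := sqr_ge0 `|y|; lra.
Qed.

(** * Riesz representation on a subspace *)

Section Riesz.
Context (D : set X) (f : X -> R).
Context (D0 : D 0).
Context (DP : forall (a : R) (x y : X), D x -> D y -> D (a *: x + y)).
Context (fP : forall (a : R) (x y : X), D x -> D y ->
  f (a *: x + y) = a * f x + f y).
Context (f_cont : {within D, continuous f}).

Lemma within_continuous_bounded :
  exists C : R, forall y, D y -> `|f y| <= C * `|y|.
Proof.
have f0 : f 0 = 0 by have := fP 1 D0 D0; rewrite scale1r addr0; lra.
move/subspace_continuousP: f_cont => /(_ _ D0) /cvgrPdist_lt /(_ 1 ltr01).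
rewrite near_withinE => /nbhs_normP[d /= d0 dP].
exists (2 / d) => y Dy.
have [->|y0] := eqVneq y 0; first by rewrite f0 !normr0 mulr0.
have n0 : 0 < `|y| by rewrite normr_gt0.
pose t := d / 2 / `|y|.
have t0 : 0 < t by rewrite !divr_gt0.
have Dty : D (t *: y) by rewrite -[_ *: _]addr0; exact: DP.
have fty : f (t *: y) = t * f y by rewrite -[_ *: _]addr0 fP // f0 addr0.
have := dP (t *: y); rewrite /= /from_subspace f0 !sub0r !normrN => /(_ _ Dty).
rewrite fty normrM normrZ (gtr0_norm t0).
(* t was chosen so that t y has norm d / 2, inside the ball where |f| < 1. *)
have -> : t * `|y| = d / 2 by rewrite /t divfK ?gt_eqF.
have -> : 2 / d * `|y| = t^-1.
  by rewrite /t; field; rewrite !gt_eqF.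
move=> /(_ _)/ltW H; rewrite -[t^-1]mulr1 ler_pdivlMl //; apply: H.
by lra.
Qed.

(** Take a whose value J a is within e^2 of the infimum of
    J y = |y|^2 - 2 f y over D. Then J (t h + a) >= J a - e^2 for all t, a
    quadratic inequality in t whose discriminant gives
    ((a | h) - f h)^2 <= e^2 |h|^2. *)
Lemma near_representative (e : R) : 0 < e ->
  exists2 a, D a & forall h, D h -> `|ip a h - f h| <= e * `|h|.
Proof.
move=> e0; have [C fC] := within_continuous_bounded.
pose J y := `|y| ^+ 2 - 2 * f y.
have infJ : has_inf (J @` D).
  split; first by exists (J 0), 0.
  (* J y >= |y|^2 - 2 C |y| >= - C^2 *)
  exists (- C ^+ 2) => _ [y Dy <-]; rewrite /J.
  have := fC y Dy; rewrite ler_norml => /andP[_].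
  have := sqr_ge0 (`|y| - C); rewrite sqrrB; lra.
have [_ [a Da <-] Ja] := inf_adherent (exprn_gt0 2 e0) infJ.
exists a => // h Dh.
have Jmin (t : R) : 0 <= t ^+ 2 * `|h| ^+ 2 + 2 * t * (ip a h - f h) + e ^+ 2.
  have : inf (J @` D) <= J (t *: h + a).
    by apply: ge_inf; [case: infJ|exists (t *: h + a) => //; exact: DP].
  move: Ja; rewrite /J sqr_norm_linear fP //; lra.
have [h0|h0] := eqVneq h 0.
  have f0 : f 0 = 0 by have := fP 1 D0 D0; rewrite scale1r addr0; lra.
  by rewrite h0 f0 linear0r subr0 !normr0 mulr0.
have n0 : 0 < `|h| by rewrite normr_gt0.
rewrite -ler_sqr ?nnegrE ?mulr_ge0 ?(ltW e0) // real_normK ?num_real // exprMn.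
(* the value of t at which the quadratic is smallest *)
have := Jmin (- (ip a h - f h) / `|h| ^+ 2).
set s := ip a h - f h.
have -> : (- s / `|h| ^+ 2) ^+ 2 * `|h| ^+ 2 + 2 * (- s / `|h| ^+ 2) * s + e ^+ 2
  = (e ^+ 2 * `|h| ^+ 2 - s ^+ 2) / `|h| ^+ 2.
  by field; rewrite gt_eqF.
by rewrite pmulr_lge0 ?invr_gt0 ?exprn_gt0 // subr_ge0.
Qed.

(** The near representatives a_n for e = 1 / (n + 1) form a Cauchy sequence:
    testing the estimates for a_n and a_m against h = a_n - a_m bounds
    |h|^2 = (a_n | h) - (a_m | h) by (1 / (n + 1) + 1 / (m + 1)) |h|. Their limit
    in X represents f exactly. *)
Lemma riesz_representation : exists z, forall h, D h -> ip z h = f h.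
Proof.
have /choice[a aP] (n : nat) :
    exists b, D b /\ forall h, D h -> `|ip b h - f h| <= n.+1%:R^-1 * `|h|.
  have [|b Db bP] := @near_representative n.+1%:R^-1; first by rewrite invr_gt0.
  by exists b.
have aD n : D (a n) by case: (aP n).
have {}aP n := (aP n).2.
have a_dist n m : `|a n - a m| <= n.+1%:R^-1 + m.+1%:R^-1.
  have [h hE] : exists h, h = a n - a m by exists (a n - a m).
  have Dh : D h by rewrite hE -scaleN1r addrC; exact: DP.
  rewrite -hE; have [->|h0] := eqVneq h 0; first by rewrite normr0 addr_ge0.
  rewrite -(@ler_pM2r _ `|h|) ?normr_gt0 //.
  rewrite -expr2 -ipxx {1}hE ipBl mulrDl.
  apply: le_trans (ler_norm _) _.
  apply: le_trans (ler_distD (f h) _ _) _.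
  by rewrite (distrC (f h)); apply: lerD; exact: aP.
have inv_near (e : R) : 0 < e -> \forall n \near \oo, n.+1%:R^-1 < e.
  by move=> e0; exact: (near_infty_natSinv_lt (PosNum e0)).
have /cauchy_cvgP a_cvg : cauchy (a @ \oo).
  apply/cauchy_ballP => e e0.
  have e20 : 0 < e / 2 by rewrite divr_gt0.
  exists (a @` [set n | n.+1%:R^-1 < e / 2], a @` [set n | n.+1%:R^-1 < e / 2]).
    split; rewrite /nbhs /=; apply: filterS (inv_near _ e20) => n ?;
      by exists n.
  move=> [_ _] [[n /= ne <-] [m /= me <-]].
  rewrite -ball_normE /=; apply: le_lt_trans (a_dist n m) _.
  by rewrite [e]splitr ltrD.
exists (lim (a @ \oo)) => h Dh; set z := lim _.
apply/eqP; rewrite -subr_eq0 -normr_le0; apply/ler_addgt0Pr => e e0.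
rewrite add0r.
have h1 : 0 < `|h| + 1 by rewrite ltr_wpDl.
pose d := e / 2 / (`|h| + 1).
have d0 : 0 < d by rewrite !divr_gt0.
have [n [zn nd]] : exists n, `|z - a n| < d /\ n.+1%:R^-1 < d.
  near \oo => n; exists n; split; near: n; last exact: inv_near.
  by move/cvgrPdist_lt : a_cvg; apply.
have -> : ip z h - f h = ip (z - a n) h + (ip (a n) h - f h).
  by rewrite ipBl; ring.
apply: le_trans (ler_normD _ _) _.
have -> : e = d * (`|h| + 1) + d * (`|h| + 1) by rewrite /d; field; rewrite gt_eqF.
have hle : `|h| <= `|h| + 1 by rewrite lerDl.
apply: lerD.
  apply: le_trans (cauchy_schwarz _ _) _; apply: ler_pM => //; exact: ltW.
apply: le_trans (aP n h Dh) _; apply: ler_pM => //; exact: ltW.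
Unshelve. all: by end_near. Qed.

End Riesz.

(** * Lagrangian extensions of isotropic sets *)

Definition symplectic (p q : X * X) : R := ip p.1 q.2 - ip p.2 q.1.

Definition isotropic (G : set (X * X)) : Prop :=
  forall p q, G p -> G q -> symplectic p q = 0.

Definition lagrangian (L : set (X * X)) : Prop :=
  forall p, L p <-> (forall q, L q -> symplectic p q = 0).

Lemma symplecticC (p q : X * X) : symplectic p q = - symplectic q p.
Proof. by rewrite /symplectic opprB (ipC _ q.1) (ipC _ q.2). Qed.

(** Zorn's lemma is applied to the sets N with G `|` N isotropic, a property
    that also holds for the union of the empty chain. For p orthogonal to a
    maximal G `|` N, the set G `|` (p |` N) is still isotropic, because
    symplectic p p = 0; so p was already there. *)
Lemma isotropic_sub_lagrangian (G : set (X * X)) :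
  isotropic G -> exists2 L, lagrangian L & G `<=` L.
Proof.
move=> isoG.
pose P (H : set (X * X)) := isotropic (G `|` H).
have [|N [PN maxN]] := @Zorn_bigcup _ P.
  move=> F FP Ftot p q [Gp|[H FH Hp]] [Gq|[K FK Kq]].
  - exact: isoG.
  - by apply: (FP _ FK); [left|right].
  - by apply: (FP _ FH); [right|left].
  - have [HK|KH] := Ftot _ _ FH FK.
      by apply: (FP _ FK); right => //; exact: HK.
    by apply: (FP _ FH); right => //; exact: KH.
exists (G `|` N); last by move=> p; left.
move=> p; split=> [Lp q Lq|pL]; first exact: PN.
apply: contrapT => nLp.
apply: (maxN (p |` N)).
  split=> [q|sub]; first by right.
  by apply: nLp; right; apply: sub; left.
have pp : symplectic p p = 0 by have := symplecticC p p; lra.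
have Lp q : (G `|` (p |` N)) q -> q = p \/ (G `|` N) q.
  by move=> [?|[->|?]]; [right; left|left|right; right].
move=> q r /Lp[->|Lq] /Lp[->|Lr] //; [exact: pL| |exact: PN].
by rewrite symplecticC pL ?oppr0.
Qed.

(** * Operators with Lagrangian graph *)

Definition graph (A : partial_map X) : set (X * X) :=
  [set p | pdom A p.1 /\ A p.1 = p.2].

Definition partial_of_graph (L : set (X * X)) : partial_map X :=
  PartialMap [set x | exists y, L (x, y)] (fun x => xget 0 [set y | L (x, y)]).

(** Linearity is not built into the Zorn argument: a symplectic orthogonal is
    always a subspace. *)
Lemma lagrangian_linear (L : set (X * X)) (a : R) (p q : X * X) :
  lagrangian L -> L p -> L q -> L (a *: p + q).
Proof.
move=> lagL Lp Lq; apply/lagL => r Lr.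
have /lagL/(_ _ Lr) := Lp; have /lagL/(_ _ Lr) := Lq.
rewrite /symplectic /= !ip_linear => q0 p0.
transitivity (a * (ip p.1 r.2 - ip p.2 r.1) + (ip q.1 r.2 - ip q.2 r.1)).
  by ring.
by rewrite p0 q0 mulr0 addr0.
Qed.

Section LagrangianGraph.
Context (L : set (X * X)).
Context (lagL : lagrangian L).
Local Notation M := (partial_of_graph L).
Context (M_dense : dense (pdom M)).

(** y - y' is orthogonal to the domain, since (y | u) = (x | v) = (y' | u) for
    every (u, v) in L. *)
Lemma lagrangian_functional (x y y' : X) : L (x, y) -> L (x, y') -> y = y'.
Proof.
move=> Ly Ly'; apply/eqP; rewrite -subr_eq0; apply/eqP.
apply: dense_orthogonal_eq0 M_dense _ => u [v Lv].
have /lagL/(_ _ Lv) := Ly; have /lagL/(_ _ Lv) := Ly'.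
by rewrite /symplectic /= ipBl; lra.
Qed.

Lemma partial_of_graphE (x y : X) : L (x, y) -> M x = y.
Proof.
move=> Lxy; apply: xget_unique => //= y' Ly'.
exact: lagrangian_functional Ly' Lxy.
Qed.

Lemma partial_of_graphP (x : X) : pdom M x -> L (x, M x).
Proof. by move=> [y Lxy]; rewrite (partial_of_graphE Lxy). Qed.

Lemma partial_of_graph_linear : linear_partial M.
Proof.
have ML a x y : pdom M x -> pdom M y -> L (a *: x + y, a *: M x + M y).
  move=> /partial_of_graphP Lx /partial_of_graphP Ly.
  exact: lagrangian_linear a _ _ lagL Lx Ly.
split=> [|a x y Mx My|a x y Mx My].
- by exists 0; apply/lagL => q _; rewrite /symplectic /= !linear0l subr0.
- by exists (a *: M x + M y); exact: ML.
- exact/partial_of_graphE/ML.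
Qed.

Lemma partial_of_graph_symmetric : symmetric_partial ip M.
Proof.
move=> x y /partial_of_graphP/lagL + /partial_of_graphP Ly => /(_ _ Ly).
by rewrite /symplectic /=; lra.
Qed.

(** Any z satisfying the adjoint identity at x lies over x in L, L being its own orthogonal;
    this settles both the domain and the value of the adjoint. The vector z
    comes from the Riesz theorem; conversely, on the domain of M, symmetry turns
    y |-> (x | M y) into the continuous functional y |-> (M x | y). *)
Lemma lagrangian_self_adjoint : self_adjoint ip M.
Proof.
have [M0 MP MZ] := partial_of_graph_linear.
split; first exact: M_dense.
have adj x z : (forall y, pdom M y -> ip z y = ip x (M y)) -> L (x, z).
  move=> zP; apply/lagL => -[u v] Luv.
  have /zP : pdom M u by exists v.
  by rewrite (partial_of_graphE Luv) /symplectic /= => ->; rewrite subrr.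
split.
  apply/seteqP; split=> x.
    move=> Mx; apply/subspace_continuousP => y My.
    rewrite /from_subspace -(partial_of_graph_symmetric Mx My).
    apply: cvg_trans (cvg_within_filter _ (@ip_continuous (M x) y)).
    apply: near_eq_cvg; rewrite near_withinE; near=> w => Mw.
    exact: partial_of_graph_symmetric.
  move=> cont.
  have [|z zP] := riesz_representation M0 MP _ cont.
    by move=> a u v Mu Mv; rewrite MZ // ip_linear_r.
  by exists z; exact: adj.
move=> x Mx; apply/esym/xget_unique => [y My|z zP].
  exact: partial_of_graph_symmetric.
exact/esym/partial_of_graphE/adj.
Unshelve. all: by end_near. Qed.

End LagrangianGraph.

End HilbertSpace.

Theorem mainTheorem1 (R : realType) (X : completeNormedModType R)
    (ip : {dot X for idfun}) (ip_norm : induces_norm ip)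
    (A : partial_map X) (A_linear : linear_partial A) (A_dense : densely_defined A)
    (A_sym : symmetric_partial ip A) :
  exists M : partial_map X,
    [/\ linear_partial M, self_adjoint ip M & extends M A].
Proof.
have isoA : isotropic ip (graph A).
  move=> [x _] [u _] [/= Ax <-] [/= Au <-].
  by rewrite /symplectic /= A_sym // subrr.
have [L lagL AL] := isotropic_sub_lagrangian isoA.
have AM : pdom A `<=` pdom (partial_of_graph L).
  by move=> x Ax; exists (A x); exact: AL.
have M_dense : dense (pdom (partial_of_graph L)).
  move=> O O0 openO; have [x [Ox Ax]] := A_dense O O0 openO.
  by exists x; split=> //; exact: AM.
exists (partial_of_graph L); split.
- exact: partial_of_graph_linear.
- exact: lagrangian_self_adjoint.
- split=> // x Ax; apply: partial_of_graphE => //; exact: AL.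
Qed.
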